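(* Let $a,b,c\in\mathbb{C}$ with $\Re(b)>0$, $\Re(b+a+c)>0$, $\Re(b+a-c)>0$, $\Re(b-a+c)>0$, $\Re(b-a-c)>0$, and $\frac{a+c}{b},\frac{a-c}{b}\notin\{\pm1,\pm3,\pm5,\dots\}$. Fix a square root $\sqrt{a^2+c^2}$, put $\nu=\frac{\sqrt{a^2+c^2}}{2b}$, $\tau_1=\frac12-\frac{a+c}{2b}$, $\tau_2=\frac12-\frac{a-c}{2b}$, $\tau_3=\frac12+\frac{a+c}{2b}$, $\tau_4=\frac12+\frac{a-c}{2b}$, and $Q=(b-a-c)(b+a+c)(b-a+c)(b+a-c)$. Assume $\frac12\pm\nu\notin\mathbb{Z}_0^-$ and $1+\tau_j\notin\mathbb{Z}_0^-$ ($j=1,\dots,4$). Then $$ {}_8F_7\!\left(\begin{matrix}1,\ \frac32,\ \frac32-\nu,\ \frac32+\nu,\ \tau_1,\ \tau_2,\ \tau_3,\ \tau_4\\ \frac12,\ \frac12-\nu,\ \frac12+\nu,\ 1+\tau_1,\ 1+\tau_2,\ 1+\tau_3,\ 1+\tau_4\end{matrix};\,-1\right) =\frac{\pi Q}{2\,(b^4-a^2b^2-c^2b^2)}\cdot\frac{\cos\!\big(\frac{a\pi}{2b}\big)\cos\!\big(\frac{c\pi}{2b}\big)}{\cos\!\big(\frac{c\pi}{b}\big)+\cos\!\big(\frac{a\pi}{b}\big)}. $$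
   Context: $\mathbb{Z}_0^-=\{0,-1,-2,\dots\}$. The Pochhammer symbol is $(\lambda)_0=1$, $(\lambda)_n=\lambda(\lambda+1)\cdots(\lambda+n-1)$ for $n\ge1$. The generalized hypergeometric series is ${}_pF_q\!\left(\begin{matrix}\alpha_1,\dots,\alpha_p\\ \beta_1,\dots,\beta_q\end{matrix};z\right)=\sum_{n=0}^\infty\frac{(\alpha_1)_n\cdots(\alpha_p)_n}{(\beta_1)_n\cdots(\beta_q)_n}\frac{z^n}{n!}$ (with no $\beta_j\in\mathbb{Z}_0^-$). *)

(* Defs.v *)
From Stdlib Require Import Reals List Arith Factorial.
Open Scope R_scope.

Definition Cplx : Type := (R * R)%type.
Definition Re (z : Cplx) : R := fst z.
Definition Im (z : Cplx) : R := snd z.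
Definition RtoC (x : R) : Cplx := (x, 0).
Definition Cadd (z w : Cplx) : Cplx := (fst z + fst w, snd z + snd w).
Definition Copp (z : Cplx) : Cplx := (- fst z, - snd z).
Definition Csub (z w : Cplx) : Cplx := Cadd z (Copp w).
Definition Cmul (z w : Cplx) : Cplx :=
  (fst z * fst w - snd z * snd w, fst z * snd w + snd z * fst w).
Definition Cinv (z : Cplx) : Cplx :=
  (fst z / (fst z ^ 2 + snd z ^ 2), - snd z / (fst z ^ 2 + snd z ^ 2)).
Definition Cdiv (z w : Cplx) : Cplx := Cmul z (Cinv w).
Definition Ci : Cplx := (0, 1).
Fixpoint Cpow (z : Cplx) (n : nat) : Cplx :=
  match n with O => RtoC 1 | S m => Cmul z (Cpow z m) end.

Definition Cexp (z : Cplx) : Cplx := (exp (fst z) * cos (snd z), exp (fst z) * sin (snd z)).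
Definition Ccos (z : Cplx) : Cplx :=
  Cdiv (Cadd (Cexp (Cmul Ci z)) (Cexp (Copp (Cmul Ci z)))) (RtoC 2).

Definition in_Z0minus (z : Cplx) : Prop := exists k : nat, z = RtoC (- INR k).

Fixpoint poch (l : Cplx) (n : nat) : Cplx :=
  match n with O => RtoC 1 | S m => Cmul (poch l m) (Cadd l (RtoC (INR m))) end.

Definition Cprod (l : list Cplx) : Cplx := fold_right Cmul (RtoC 1) l.

Definition hyp_term (alphas betas : list Cplx) (z : Cplx) (n : nat) : Cplx :=
  Cdiv (Cmul (Cprod (map (fun a => poch a n) alphas)) (Cpow z n))
       (Cmul (Cprod (map (fun b => poch b n) betas)) (RtoC (INR (fact n)))).

Fixpoint hyp_partial (alphas betas : list Cplx) (z : Cplx) (N : nat) : Cplx :=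
  match N with
  | O => hyp_term alphas betas z O
  | S M => Cadd (hyp_partial alphas betas z M) (hyp_term alphas betas z (S M))
  end.

Definition hyp_sum (alphas betas : list Cplx) (z : Cplx) (L : Cplx) : Prop :=
  Un_cv (fun N => Re (hyp_partial alphas betas z N)) (Re L) /\
  Un_cv (fun N => Im (hyp_partial alphas betas z N)) (Im L).

Definition is_odd_int (w : Cplx) : Prop :=
  exists k : nat, w = RtoC (INR (2 * k + 1)) \/ w = RtoC (- INR (2 * k + 1)).

(* Main.v *)
From Coquelicot Require Import Coquelicot.
Require Import Defs.
From Stdlib Require Import Reals List Lra Lia ZArith.
Import ListNotations.
Open Scope R_scope.

(** The quotients of Pochhammer symbols telescope.  With [k = 2n+1], [w1 = (a+c)/b] and
    [w2 = (a-c)/b], the [n]-th term is a constant multiple of [(-1)^n] times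
    [1/(k-w1) + 1/(k+w1) + 1/(k-w2) + 1/(k+w2)], so the sum follows from the partial
    fraction expansion [sum (-1)^n (1/(k-w) + 1/(k+w)) = pi / (2 cos (pi w / 2))].
    For the latter, the [n]-th summand times [cos (pi w / 2)] is the integral over
    [[0, pi/2]] of [2 cos (w x) cos (k x)], and [2 sum_(n <= N) cos (k x)] is the kernel
    [sin (2 (N+1) x) / sin x]; hence replacing [cos (w x)] by its value at [0] does not
    change the limit, which for [w = 0] is twice the Leibniz series. *)

(** * Derivatives of finite sums and mean value estimates *)

Lemma is_derive_sum_f_R0 (f f' : nat -> R -> R) (N : nat) (x : R) :
  (forall n, is_derive (f n) x (f' n x)) ->
  is_derive (fun y => sum_f_R0 (fun n => f n y) N) x (sum_f_R0 (fun n => f' n x) N).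
Proof.
  intros H; induction N as [|N IH]; simpl; [apply H|].
  apply @is_derive_plus; [exact IH | apply H].
Qed.

Lemma increment_bound (f f' : R -> R) (a b D : R) :
  a <= b -> (forall x, a <= x <= b -> is_derive f x (f' x)) ->
  (forall x, a <= x <= b -> Rabs (f' x) <= D) ->
  Rabs (f b - f a) <= D * (b - a).
Proof.
  intros ab Hd Hb.
  destruct (MVT_gen f a b f') as [x [Hx E]].
  - intros x Hx; rewrite Rmin_left in Hx by lra; rewrite Rmax_right in Hx by lra.
    apply Hd; lra.
  - intros x Hx; rewrite Rmin_left in Hx by lra; rewrite Rmax_right in Hx by lra.
    apply continuity_pt_filterlim, (ex_derive_continuous f).
    exists (f' x); now apply Hd.
  - rewrite Rmin_left in Hx by lra; rewrite Rmax_right in Hx by lra.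
    rewrite E, Rabs_mult, (Rabs_pos_eq (b - a)) by lra.
    apply Rmult_le_compat_r; [lra | now apply Hb].
Qed.

(** The mean value theorem gives [sin x = x cos y] with [y] between 0 and [x], and [PI / 3] is where
    the cosine comes down to 1/2. *)
Lemma half_le_sin (x : R) : 0 <= x <= PI / 3 -> x / 2 <= sin x.
Proof.
  intros Hx; pose proof PI_RGT_0.
  destruct (MVT_gen sin 0 x cos) as [y [Hy E]].
  - intros t _; auto_derive; [trivial | ring].
  - intros t _; apply continuity_sin.
  - rewrite Rmin_left in Hy by lra; rewrite Rmax_right in Hy by lra.
    rewrite sin_0 in E.
    assert (1 / 2 <= cos y) by (rewrite <- cos_PI3; apply cos_decr_1; lra).
    nra.
Qed.

(** * The kernel of odd cosines and its localization at zero *)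

Definition odd_cos_sum (N : nat) (x : R) : R :=
  sum_f_R0 (fun n => cos (INR (2 * n + 1) * x)) N.

(** The sum telescopes, since [2 cos ((2n+1) x) sin x = sin ((2n+2) x) - sin (2n x)]. *)
Lemma odd_cos_sum_sin (N : nat) (x : R) :
  2 * odd_cos_sum N x * sin x = sin (2 * INR (S N) * x).
Proof.
  unfold odd_cos_sum; induction N as [|N IH].
  - simpl; replace (2 * 1 * x) with (2 * x) by ring.
    rewrite sin_2a, Rmult_1_l; ring.
  - rewrite tech5, Rmult_plus_distr_l, Rmult_plus_distr_r, IH.
    rewrite plus_INR, mult_INR, (S_INR (S N)).
    replace (2 * INR (S N) * x) with ((INR 2 * INR (S N) + INR 1) * x - x)
      by (simpl (INR 2); simpl (INR 1); ring).
    replace (2 * (INR (S N) + 1) * x) with ((INR 2 * INR (S N) + INR 1) * x + x)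
      by (simpl (INR 2); simpl (INR 1); ring).
    rewrite sin_minus, sin_plus; ring.
Qed.

(* Away from [0] one integrates [g x / sin x * sin (2 (N+1) x)] by parts; near [0]
   the quotient [g / sin] is bounded.  Only primitives appear, so the mean value
   inequality replaces integration. *)
Lemma dirichlet_kernel_localization (g g' : R -> R) (P : nat -> R -> R) (B : R) :
  g 0 = 0 -> (forall x, is_derive g x (g' x)) ->
  (forall x, 0 <= x <= PI / 2 -> Rabs (g x) <= B /\ Rabs (g' x) <= B) ->
  (forall N x, is_derive (P N) x (2 * g x * odd_cos_sum N x)) ->
  (forall N, P N 0 = 0) ->
  Un_cv (fun N => P N (PI / 2)) 0.
Proof.
  intros g0 Dg Hb DP P0 eps Heps.
  pose proof PI_RGT_0 as Hpi; pose proof PI_4 as Hpi4.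
  assert (B0 : 0 <= B).
  { destruct (Hb 0) as [H _]; [lra|]. pose proof (Rabs_pos (g 0)); lra. }
  (* The bound [PI / 3] makes [half_le_sin] available on [[0, d]]. The other bound makes [2 B d]
     less than [eps / 2]; it uses [B + 1] because [B] may be 0. *)
  set (d := Rmin (PI / 3) (eps / (4 * (B + 1)))).
  assert (Hd0 : 0 < d) by (apply Rmin_pos; [lra | apply Rdiv_lt_0_compat; lra]).
  assert (Hd1 : d <= PI / 3) by apply Rmin_l.
  assert (Hd2 : 2 * B * d < eps / 2).
  { assert (H : d <= eps / (4 * (B + 1))) by apply Rmin_r.
    apply (Rmult_le_compat_r (4 * (B + 1))) in H; [|lra].
    unfold Rdiv in H at 1; rewrite Rmult_assoc, Rinv_l, Rmult_1_r in H by lra.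
    nra. }
  set (s := sin d).
  assert (Hs : 0 < s) by (apply sin_gt_0; lra).
  assert (Hs2 : 0 < s * s) by nra.
  (* Here [|g x| <= B x] and [sin x >= x / 2], so the derivative [g x sin (2 (N+1) x) / sin x] is at
     most [2 B] in absolute value, uniformly in [N]. The point 0, where [sin] cannot be cancelled,
     is treated apart. *)
  assert (near : forall N, Rabs (P N d) <= 2 * B * d).
  { intros N.
    replace (P N d) with (P N d - P N 0) by (rewrite P0; ring).
    replace (2 * B * d) with (2 * B * (d - 0)) by ring.
    apply (increment_bound (P N) (fun x => 2 * g x * odd_cos_sum N x)); [lra | auto |].
    intros x Hx.
    destruct (Req_dec x 0) as [-> | x0].
    { rewrite g0, Rmult_0_r, Rmult_0_l, Rabs_R0; lra. }
    assert (Hg : Rabs (g x) <= B * x).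
    { replace (g x) with (g x - g 0) by (rewrite g0; ring).
      replace (B * x) with (B * (x - 0)) by ring.
      apply (increment_bound g g'); [lra | auto |].
      intros y Hy; apply Hb; lra. }
    assert (Hx2 := half_le_sin x ltac:(lra)).
    apply (Rmult_le_reg_r (sin x)); [lra|].
    rewrite <- (Rabs_pos_eq (sin x)) at 1 by lra.
    rewrite <- Rabs_mult.
    replace (2 * g x * odd_cos_sum N x * sin x)
      with (g x * sin (2 * INR (S N) * x)) by (rewrite <- odd_cos_sum_sin; ring).
    rewrite Rabs_mult.
    assert (Rabs (sin (2 * INR (S N) * x)) <= 1) by (apply Rabs_le, SIN_bound).
    pose proof (Rabs_pos (g x)); pose proof (Rabs_pos (sin (2 * INR (S N) * x))).
    nra. }
  assert (sin_ge : forall x, d <= x <= PI / 2 -> s <= sin x).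
  { intros x Hx; apply sin_incr_1; lra. }
  assert (far : forall N,
    Rabs (P N (PI / 2) - P N d) <= 3 * (B / (INR (S N) * (s * s)))).
  { intros N; set (M := INR (S N)).
    assert (HM : 0 < M) by (apply lt_0_INR; lia).
    (* [k g] is the correction from integration by parts: its derivative cancels
       [g x sin (2 M x) / sin x] and leaves only terms with a factor [1 / M]. *)
    set (k := fun x => cos (2 * M * x) / (2 * M * sin x)).
    (* [C] bounds the derivative of [P N + k g], because [|g' sin - g cos| <= 2 B] and [sin >= s].
       Since [s <= 1], the boundary terms [k g] are at most [C / 2]. *)
    set (C := B / (M * (s * s))).
    assert (HC : C * (M * (s * s)) = B) by (unfold C; field; lra).
    assert (C0 : 0 <= C) by (apply Rdiv_le_0_compat; [lra | nra]).
    assert (Hk : forall x, d <= x <= PI / 2 -> Rabs (k x * g x) <= C / 2).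
    { intros x Hx; specialize (sin_ge x Hx).
      destruct (Hb x) as [Hg _]; [lra|].
      assert (s <= 1) by apply SIN_bound.
      assert (Hc : Rabs (cos (2 * M * x)) <= 1) by (apply Rabs_le, COS_bound).
      apply (Rmult_le_reg_r (2 * M * sin x)); [nra|].
      rewrite <- (Rabs_pos_eq (2 * M * sin x)) at 1 by nra.
      rewrite <- Rabs_mult.
      replace (k x * g x * (2 * M * sin x)) with (cos (2 * M * x) * g x)
        by (unfold k; field; split; lra).
      rewrite Rabs_mult.
      pose proof (Rabs_pos (g x)); pose proof (Rabs_pos (cos (2 * M * x))).
      apply Rle_trans with B; [nra|].
      rewrite <- HC.
      replace (C / 2 * (2 * M * sin x)) with (C * (M * sin x)) by field.
      apply Rmult_le_compat_l; [lra|]. apply Rmult_le_compat_l; nra. }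
    assert (HT : Rabs ((P N (PI / 2) + k (PI / 2) * g (PI / 2)) - (P N d + k d * g d))
                 <= C * (PI / 2 - d)).
    { apply (increment_bound (fun x => P N x + k x * g x)
        (fun x => cos (2 * M * x) * (g' x * sin x - g x * cos x)
                  / (2 * M * (sin x * sin x)))); [lra | |].
      - intros x Hx; specialize (sin_ge x Hx).
        assert (Dk : is_derive k x (- sin (2 * M * x) / sin x
                   - cos (2 * M * x) * cos x / (2 * M * (sin x * sin x)))).
        { unfold k; auto_derive; [nra | field; split; lra]. }
        evar_last.
        { apply @is_derive_plus; [apply DP | apply @is_derive_mult; [exact Dk | apply Dg |]].
          intros; apply Rmult_comm. }
        unfold plus, mult; simpl.
        replace (2 * g x * odd_cos_sum N x)
          with (g x * sin (2 * M * x) / sin x)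
          by (unfold M; rewrite <- odd_cos_sum_sin; field; lra).
        unfold k; field; split; lra.
      - intros x Hx; specialize (sin_ge x Hx).
        destruct (Hb x) as [Hg Hg']; [lra|].
        assert (Hc : Rabs (cos (2 * M * x)) <= 1) by (apply Rabs_le, COS_bound).
        assert (Hq : Rabs (g' x * sin x - g x * cos x) <= 2 * B).
        { apply Rabs_le; apply Rabs_le_between in Hg; apply Rabs_le_between in Hg'.
          pose proof (SIN_bound x); pose proof (COS_bound x); split; nra. }
        assert (s * s <= sin x * sin x) by nra.
        assert (0 < 2 * M * (sin x * sin x)) by nra.
        unfold Rdiv; rewrite Rabs_mult, Rabs_inv, Rabs_mult, (Rabs_pos_eq (2 * M * _)) by lra.
        apply (Rmult_le_reg_r (2 * M * (sin x * sin x))); [lra|].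
        rewrite Rmult_assoc, Rinv_l, Rmult_1_r by lra.
        apply Rle_trans with (2 * B).
        + pose proof (Rabs_pos (cos (2 * M * x))).
          pose proof (Rabs_pos (g' x * sin x - g x * cos x)); nra.
        + rewrite <- HC.
          replace (C * (2 * M * (sin x * sin x))) with (2 * (C * (M * (sin x * sin x)))) by ring.
          apply Rmult_le_compat_l; [lra|]. apply Rmult_le_compat_l; [lra|].
          apply Rmult_le_compat_l; lra. }
    (* The interval has length at most 2, as [PI <= 4], which contributes [2 C]; the two boundary
       terms contribute [C / 2] each. This is the factor 3. *)
    pose proof (Hk d ltac:(lra)) as K1; pose proof (Hk (PI / 2) ltac:(lra)) as K2.
    apply Rabs_le; apply Rabs_le_between in HT; apply Rabs_le_between in K1;
      apply Rabs_le_between in K2; nra. }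
  destruct (INR_unbounded (6 * B / (s * s * eps))) as [N0 HN0].
  exists N0; intros N HN; unfold Rdist; rewrite Rminus_0_r.
  specialize (near N); specialize (far N).
  assert (HNN : INR N0 <= INR (S N)) by (apply le_INR; lia).
  assert (HM : 0 < INR (S N)) by (apply lt_0_INR; lia).
  assert (Hfin : 3 * (B / (INR (S N) * (s * s))) < eps / 2).
  { assert (H6 : 6 * B < INR (S N) * (s * s * eps)).
    { apply Rlt_div_l; [nra | lra]. }
    apply (Rmult_lt_reg_r (INR (S N) * (s * s))); [nra|].
    replace (3 * (B / (INR (S N) * (s * s))) * (INR (S N) * (s * s))) with (3 * B)
      by (field; lra). nra. }
  replace (P N (PI / 2)) with ((P N (PI / 2) - P N d) + P N d) by ring.
  eapply Rle_lt_trans; [apply Rabs_triang|]; lra.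
Qed.

(** * Complex pairs as a field, and the embedding of the reals *)

Lemma Cplx_field_theory :
  field_theory (RtoC 0) (RtoC 1) Cadd Cmul Csub Copp Cdiv Cinv (@eq Cplx).
Proof.
  split; [split | | |].
  all: try (intros [x1 y1] [x2 y2] [x3 y3] || intros [x1 y1] [x2 y2] || intros [x1 y1]).
  all: try (unfold Cdiv, Csub, Cadd, Cmul, Copp, RtoC; simpl; f_equal; ring).
  - intros H; injection H; lra.
  - intros H; unfold Cmul, Cinv, RtoC; simpl.
    assert (x1 * x1 + y1 * y1 <> 0)
      by (intros E; apply H; unfold RtoC; f_equal; nra).
    f_equal; field; contradict H; nra.
Qed.

Add Field Cplx_field : Cplx_field_theory.

Lemma RtoC_inj (x y : R) : RtoC x = RtoC y -> x = y.
Proof. intros H; now injection H. Qed.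

Lemma RtoC_plus (x y : R) : RtoC (x + y) = Cadd (RtoC x) (RtoC y).
Proof. unfold RtoC, Cadd; simpl; f_equal; ring. Qed.

Lemma RtoC_mult (x y : R) : RtoC (x * y) = Cmul (RtoC x) (RtoC y).
Proof. unfold RtoC, Cmul; simpl; f_equal; ring. Qed.

Lemma RtoC_opp (x : R) : RtoC (- x) = Copp (RtoC x).
Proof. unfold RtoC, Copp; simpl; f_equal; ring. Qed.

Lemma RtoC_inv (x : R) : x <> 0 -> RtoC (/ x) = Cinv (RtoC x).
Proof. intros H; unfold RtoC, Cinv; simpl; f_equal; field; auto. Qed.

Lemma Cmul_neq_0 (z w : Cplx) : z <> RtoC 0 -> w <> RtoC 0 -> Cmul z w <> RtoC 0.
Proof.
  intros Hz Hw E; apply Hw.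
  replace w with (Cmul (Cinv z) (Cmul z w)) by (field; exact Hz).
  rewrite E; ring.
Qed.

(** * Complex sine and cosine: addition formulas *)

Definition Csin (z : Cplx) : Cplx :=
  (sin (fst z) * cosh (snd z), cos (fst z) * sinh (snd z)).

(** For [z = x + i y] one has [i z = - y + i x]. Averaging the exponentials of [i z] and [- i z]
    brings [Ccos] into the form in which [Csin] is defined. *)
Lemma Ccos_eq (z : Cplx) :
  Ccos z = (cos (fst z) * cosh (snd z), - (sin (fst z) * sinh (snd z))).
Proof.
  destruct z as [x y]; unfold Ccos, Cdiv, Cexp, Cadd, Cmul, Cinv, Copp, Ci, RtoC, cosh, sinh.
  simpl.
  replace (0 * x - 1 * y) with (- y) by ring; replace (0 * y + 1 * x) with x by ring.
  rewrite cos_neg, sin_neg, Ropp_involutive; f_equal; field.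
Qed.

Lemma cosh_plus (x y : R) : cosh (x + y) = cosh x * cosh y + sinh x * sinh y.
Proof. unfold cosh, sinh; rewrite Ropp_plus_distr, !exp_plus; field. Qed.

Lemma sinh_plus (x y : R) : sinh (x + y) = sinh x * cosh y + cosh x * sinh y.
Proof. unfold cosh, sinh; rewrite Ropp_plus_distr, !exp_plus; field. Qed.

Lemma cosh_opp (x : R) : cosh (- x) = cosh x.
Proof. unfold cosh; rewrite Ropp_involutive; field. Qed.

Lemma sinh_opp (x : R) : sinh (- x) = - sinh x.
Proof. unfold sinh; rewrite Ropp_involutive; field. Qed.

Lemma Ccos_opp (z : Cplx) : Ccos (Copp z) = Ccos z.
Proof.
  rewrite !Ccos_eq; unfold Copp; simpl.
  rewrite cos_neg, sin_neg, cosh_opp, sinh_opp; f_equal; ring.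
Qed.

Lemma Ccos_plus (z w : Cplx) :
  Ccos (Cadd z w) = Csub (Cmul (Ccos z) (Ccos w)) (Cmul (Csin z) (Csin w)).
Proof.
  rewrite !Ccos_eq; unfold Csub, Cadd, Cmul, Copp, Csin; simpl.
  rewrite cos_plus, sin_plus, cosh_plus, sinh_plus; f_equal; ring.
Qed.

Lemma Csin_opp (z : Cplx) : Csin (Copp z) = Copp (Csin z).
Proof.
  unfold Csin, Copp; simpl.
  rewrite cos_neg, sin_neg, cosh_opp, sinh_opp; f_equal; ring.
Qed.

Lemma Csin_plus (z w : Cplx) :
  Csin (Cadd z w) = Cadd (Cmul (Csin z) (Ccos w)) (Cmul (Ccos z) (Csin w)).
Proof.
  rewrite !Ccos_eq; unfold Cadd, Cmul, Csin; simpl.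
  rewrite cos_plus, sin_plus, cosh_plus, sinh_plus; f_equal; ring.
Qed.

Lemma Ccos_mul_Ccos (z w : Cplx) :
  Cmul (RtoC 2) (Cmul (Ccos z) (Ccos w)) = Cadd (Ccos (Cadd z w)) (Ccos (Csub z w)).
Proof.
  unfold Csub; rewrite !Ccos_plus, Ccos_opp, Csin_opp.
  change 2 with (1 + 1); rewrite RtoC_plus; ring.
Qed.

Lemma RtoC_Ccos (x : R) : Ccos (RtoC x) = RtoC (cos x).
Proof.
  rewrite Ccos_eq; unfold RtoC; simpl; rewrite cosh_0, sinh_0; f_equal; ring.
Qed.

Lemma RtoC_Csin (x : R) : Csin (RtoC x) = RtoC (sin x).
Proof.
  unfold Csin, RtoC; simpl; rewrite cosh_0, sinh_0; f_equal; ring.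
Qed.

(** * Zeros of the complex cosine *)

Lemma odd_IZR_is_odd_int (k : Z) : is_odd_int (RtoC (2 * IZR k + 1)).
Proof.
  destruct (Z_le_gt_dec 0 k) as [H | H].
  - exists (Z.to_nat k); left; f_equal.
    rewrite plus_INR, mult_INR, (INR_IZR_INZ (Z.to_nat k)), Z2Nat.id by lia.
    simpl; ring.
  (* For negative [k], [2 k + 1 = - (2 (- k - 1) + 1)] with [- k - 1 >= 0]. *)
  - exists (Z.to_nat (- k - 1)); right; f_equal.
    rewrite plus_INR, mult_INR, (INR_IZR_INZ (Z.to_nat _)), Z2Nat.id by lia.
    rewrite minus_IZR, opp_IZR; simpl; ring.
Qed.

(** All zeros are real: [cos x cosh y = 0] forces [cos x = 0], hence [sin x] is nonzero, and
    [sin x sinh y = 0] then forces [y = 0]. *)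
Lemma Ccos_neq_0 (w : Cplx) :
  ~ is_odd_int w -> Ccos (Cmul w (RtoC (PI / 2))) <> RtoC 0.
Proof.
  pose proof PI_RGT_0 as Hpi.
  destruct w as [p q]; intros Hodd E; apply Hodd; rewrite Ccos_eq in E.
  unfold Cmul, RtoC in E; simpl in E; injection E as E1 E2.
  set (x := p * (PI / 2) - q * 0) in *; set (y := p * 0 + q * (PI / 2)) in *.
  assert (Hch : 0 < cosh y) by (unfold cosh; pose proof (exp_pos y); pose proof (exp_pos (- y)); lra).
  assert (Hc : cos x = 0) by (apply Rmult_integral in E1; lra).
  assert (Hsh : sinh y = 0).
  { pose proof (sin2_cos2 x) as H; unfold Rsqr in H; rewrite Hc in H.
    apply Ropp_eq_0_compat in E2; rewrite Ropp_involutive in E2.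
    apply Rmult_integral in E2 as [E2 | E2]; [rewrite E2 in H; lra | exact E2]. }
  assert (Hy : y = 0).
  { assert (H : exp y = exp (- y)) by (unfold sinh in Hsh; lra).
    apply exp_inv in H; lra. }
  assert (Hq : q = 0) by (unfold y in Hy; nra).
  destruct (cos_eq_0_0 x Hc) as [k Hk].
  assert (Hp : p = 2 * IZR k + 1).
  { apply (Rmult_eq_reg_r (PI / 2)); [|lra]. unfold x in Hk; lra. }
  rewrite Hq, Hp; apply odd_IZR_is_odd_int.
Qed.

(** * Primitives of the cosine in a real variable *)

(** For nonzero [w] this is the primitive of [cos (w x)] in the real variable [x] that vanishes at
    0. *)
Definition Csin_primitive (w : Cplx) (x : R) : Cplx := Cdiv (Csin (Cmul w (RtoC x))) w.

Lemma is_derive_Csin_primitive (w : Cplx) (x : R) :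
  w <> RtoC 0 ->
  is_derive (fun y => Re (Csin_primitive w y)) x (Re (Ccos (Cmul w (RtoC x)))) /\
  is_derive (fun y => Im (Csin_primitive w y)) x (Im (Ccos (Cmul w (RtoC x)))).
Proof.
  destruct w as [p q]; intros Hw.
  assert (p * p + q * q <> 0)
    by (intros E; apply Hw; unfold RtoC; f_equal; nra).
  rewrite Ccos_eq; unfold Csin_primitive, Cdiv, Cinv, Cmul, Csin, RtoC, Re, Im, cosh, sinh.
  simpl.
  split; (auto_derive; [trivial | unfold Rminus; field; contradict H; nra]).
Qed.

(** * Finite sums and limits of complex sequences *)

Fixpoint Csum (f : nat -> Cplx) (N : nat) : Cplx :=
  match N with O => f O | S M => Cadd (Csum f M) (f (S M)) end.

(** Taken componentwise, so that [hyp_sum] is by definition [Ccv] of the partial sums. *)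
Definition Ccv (u : nat -> Cplx) (l : Cplx) : Prop :=
  Un_cv (fun n => Re (u n)) (Re l) /\ Un_cv (fun n => Im (u n)) (Im l).

Lemma Un_cv_ext (u v : nat -> R) (l : R) :
  (forall n, u n = v n) -> Un_cv u l -> Un_cv v l.
Proof.
  intros H Hu eps Heps; destruct (Hu eps Heps) as [N HN].
  exists N; intros n Hn; rewrite <- H; auto.
Qed.

Lemma Un_cv_const (x : R) : Un_cv (fun _ => x) x.
Proof.
  intros eps Heps; exists O; intros n _; unfold Rdist.
  rewrite Rminus_diag, Rabs_R0; exact Heps.
Qed.

Lemma Ccv_ext (u v : nat -> Cplx) (l : Cplx) :
  (forall n, u n = v n) -> Ccv u l -> Ccv v l.
Proof.
  intros H [H1 H2]; split; (eapply Un_cv_ext; [|eassumption]);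
    intros n; simpl; now rewrite H.
Qed.

Lemma Ccv_plus (u v : nat -> Cplx) (k l : Cplx) :
  Ccv u k -> Ccv v l -> Ccv (fun n => Cadd (u n) (v n)) (Cadd k l).
Proof. intros [H1 H2] [H3 H4]; split; now apply CV_plus. Qed.

Lemma Ccv_mult_const (z : Cplx) (u : nat -> Cplx) (l : Cplx) :
  Ccv u l -> Ccv (fun n => Cmul z (u n)) (Cmul z l).
Proof.
  intros [H1 H2]; split; [apply CV_minus | apply CV_plus];
    (apply CV_mult; [apply Un_cv_const | assumption]).
Qed.

Lemma Csum_ext (f g : nat -> Cplx) (N : nat) :
  (forall n, f n = g n) -> Csum f N = Csum g N.
Proof. intros H; induction N as [|N IH]; simpl; rewrite ?IH, ?H; reflexivity. Qed.

Lemma Csum_plus (f g : nat -> Cplx) (N : nat) :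
  Csum (fun n => Cadd (f n) (g n)) N = Cadd (Csum f N) (Csum g N).
Proof. induction N as [|N IH]; simpl; rewrite ?IH; ring. Qed.

Lemma Csum_mult_const (z : Cplx) (f : nat -> Cplx) (N : nat) :
  Csum (fun n => Cmul z (f n)) N = Cmul z (Csum f N).
Proof. induction N as [|N IH]; simpl; rewrite ?IH; ring. Qed.

Lemma Re_Csum (f : nat -> Cplx) (N : nat) :
  Re (Csum f N) = sum_f_R0 (fun n => Re (f n)) N.
Proof. induction N as [|N IH]; simpl; [|rewrite <- IH]; reflexivity. Qed.

Lemma Im_Csum (f : nat -> Cplx) (N : nat) :
  Im (Csum f N) = sum_f_R0 (fun n => Im (f n)) N.
Proof. induction N as [|N IH]; simpl; [|rewrite <- IH]; reflexivity. Qed.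

(** * Values at odd multiples of [PI / 2], and the Leibniz series *)

Lemma sin_odd_mul_PI2 (n : nat) : sin (INR (2 * n + 1) * (PI / 2)) = (-1) ^ n.
Proof.
  induction n as [|n IH].
  - simpl; rewrite Rmult_1_l; apply sin_PI2.
  - replace (INR (2 * S n + 1) * (PI / 2)) with (INR (2 * n + 1) * (PI / 2) + PI).
    + rewrite neg_sin, IH; simpl; ring.
    + rewrite !plus_INR, !mult_INR, (S_INR n); simpl; field.
Qed.

Lemma cos_odd_mul_PI2 (n : nat) : cos (INR (2 * n + 1) * (PI / 2)) = 0.
Proof.
  induction n as [|n IH].
  - simpl; rewrite Rmult_1_l; apply cos_PI2.
  - replace (INR (2 * S n + 1) * (PI / 2)) with (INR (2 * n + 1) * (PI / 2) + PI).
    + rewrite neg_cos, IH; ring.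
    + rewrite !plus_INR, !mult_INR, (S_INR n); simpl; field.
Qed.

(** [Alt_PI] is defined as four times the limit of this very series, and [Alt_PI_eq] identifies it
    with [PI]. *)
Lemma leibniz_series :
  Un_cv (fun N => sum_f_R0 (fun n => (-1) ^ n / INR (2 * n + 1)) N) (PI / 4).
Proof.
  pose proof Alt_PI_eq as H; unfold Alt_PI in H; destruct exist_PI as [l Hl].
  replace (PI / 4) with l by lra.
  exact Hl.
Qed.

(** * Bounds for [cos (w x)] and its derivative on [[0, PI / 2]] *)

Lemma cosh_sinh_bound (y r : R) :
  Rabs y <= r -> Rabs (cosh y) <= exp r /\ Rabs (sinh y) <= exp r.
Proof.
  intros H; apply Rabs_le_between in H.
  assert (exp y <= exp r) by (apply Rnot_lt_le; intros E; apply exp_lt_inv in E; lra).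
  assert (exp (- y) <= exp r) by (apply Rnot_lt_le; intros E; apply exp_lt_inv in E; lra).
  pose proof (exp_pos y); pose proof (exp_pos (- y)).
  split; apply Rabs_le; unfold cosh, sinh; lra.
Qed.

Lemma Rabs_mult_bound (x y X Y : R) :
  Rabs x <= X -> Rabs y <= Y -> Rabs (x * y) <= X * Y.
Proof.
  intros Hx Hy; rewrite Rabs_mult.
  apply Rmult_le_compat; auto using Rabs_pos.
Qed.

(** Supplies the hypotheses of [dirichlet_kernel_localization] for the real part of [cos (w x) - 1]
    and for its imaginary part, with one constant for both. *)
Lemma Ccos_line_derive (w : Cplx) :
  exists f g : R -> R, exists B,
    (forall x, is_derive (fun y => Re (Ccos (Cmul w (RtoC y)))) x (f x)) /\
    (forall x, is_derive (fun y => Im (Ccos (Cmul w (RtoC y)))) x (g x)) /\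
    forall x, 0 <= x <= PI / 2 ->
      (Rabs (Re (Ccos (Cmul w (RtoC x))) - 1) <= B /\ Rabs (f x) <= B) /\
      (Rabs (Im (Ccos (Cmul w (RtoC x)))) <= B /\ Rabs (g x) <= B).
Proof.
  destruct w as [p q].
  assert (E : forall x, Ccos (Cmul (p, q) (RtoC x))
    = (cos (p * x) * cosh (q * x), - (sin (p * x) * sinh (q * x)))).
  { intros x; rewrite Ccos_eq; unfold Cmul, RtoC; simpl.
    replace (p * x - q * 0) with (p * x) by ring.
    replace (p * 0 + q * x) with (q * x) by ring; reflexivity. }
  exists (fun x => - p * (sin (p * x) * cosh (q * x)) + q * (cos (p * x) * sinh (q * x))).
  exists (fun x => - p * (cos (p * x) * sinh (q * x)) + - q * (sin (p * x) * cosh (q * x))).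
  (* Bounds [cosh (q x)] and [sinh (q x)], because [x <= PI / 2 <= 2]. *)
  set (e := exp (Rabs q * 2)).
  (* [1 + e] covers the values, the remaining summand the derivatives. *)
  exists (1 + e + (Rabs p + Rabs q) * e).
  split; [|split].
  - intros x; eapply is_derive_ext; [intros t; rewrite E; reflexivity|].
    unfold cosh, sinh, Re; simpl; auto_derive; [trivial | field].
  - intros x; eapply is_derive_ext; [intros t; rewrite E; reflexivity|].
    unfold cosh, sinh, Im; simpl; auto_derive; [trivial | field].
  - intros x Hx; rewrite E; unfold Re, Im; simpl.
    assert (Hy : Rabs (q * x) <= Rabs q * 2).
    { rewrite Rabs_mult, (Rabs_pos_eq x) by lra; pose proof PI_4.
      apply Rmult_le_compat_l; [apply Rabs_pos | lra]. }
    destruct (cosh_sinh_bound _ _ Hy) as [Hc Hs]; fold e in Hc, Hs.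
    assert (Hsin : Rabs (sin (p * x)) <= 1) by (apply Rabs_le, SIN_bound).
    assert (Hcos : Rabs (cos (p * x)) <= 1) by (apply Rabs_le, COS_bound).
    pose proof (Rabs_mult_bound _ _ _ _ Hcos Hc) as Hcc.
    pose proof (Rabs_mult_bound _ _ _ _ Hcos Hs) as Hcs.
    pose proof (Rabs_mult_bound _ _ _ _ Hsin Hc) as Hsc.
    pose proof (Rabs_mult_bound _ _ _ _ Hsin Hs) as Hss.
    assert (He : 0 <= e) by apply Rlt_le, exp_pos.
    assert (Hpe : 0 <= Rabs p * e) by (apply Rmult_le_pos; [apply Rabs_pos | exact He]).
    assert (Hqe : 0 <= Rabs q * e) by (apply Rmult_le_pos; [apply Rabs_pos | exact He]).
    assert (Hp : Rabs (- p) <= Rabs p) by (rewrite Rabs_Ropp; lra).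
    assert (Hq : Rabs (- q) <= Rabs q) by (rewrite Rabs_Ropp; lra).
    rewrite Rmult_1_l in *.
    repeat split.
    + apply Rabs_le; apply Rabs_le_between in Hcc; lra.
    + eapply Rle_trans; [apply Rabs_triang|].
      pose proof (Rabs_mult_bound _ _ _ _ Hp Hsc).
      pose proof (Rabs_mult_bound _ _ _ _ (Rle_refl (Rabs q)) Hcs); lra.
    + rewrite Rabs_Ropp; lra.
    + eapply Rle_trans; [apply Rabs_triang|].
      pose proof (Rabs_mult_bound _ _ _ _ Hp Hcs).
      pose proof (Rabs_mult_bound _ _ _ _ Hq Hsc); lra.
Qed.

(** * Partial fraction expansion of the secant *)

Definition sec_term (w : Cplx) (n : nat) : Cplx :=
  let k := RtoC (INR (2 * n + 1)) in
  Cmul (RtoC ((-1) ^ n)) (Cadd (Cinv (Csub k w)) (Cinv (Cadd k w))).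

Lemma odd_sub_neq_0 (w : Cplx) (n : nat) :
  ~ is_odd_int w ->
  Csub (RtoC (INR (2 * n + 1))) w <> RtoC 0 /\ Cadd (RtoC (INR (2 * n + 1))) w <> RtoC 0.
Proof.
  intros H; split; intros E; apply H; exists n; [left | right].
  - replace w with (Csub (RtoC (INR (2 * n + 1))) (Csub (RtoC (INR (2 * n + 1))) w)) by ring.
    rewrite E; ring.
  - rewrite RtoC_opp.
    replace w with (Csub (Cadd (RtoC (INR (2 * n + 1))) w) (RtoC (INR (2 * n + 1)))) by ring.
    rewrite E; ring.
Qed.

Lemma secant_series (w : Cplx) :
  ~ is_odd_int w ->
  Ccv (Csum (sec_term w)) (Cdiv (RtoC (PI / 2)) (Ccos (Cmul w (RtoC (PI / 2))))).
Proof.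
  intros Hw.
  pose proof (Ccos_neq_0 w Hw) as Hcos.
  set (k := fun n => RtoC (INR (2 * n + 1))).
  (* [A n x] is the primitive of [2 cos (w x) cos (k x)] vanishing at 0, with the product of cosines
     written as a sum. *)
  set (A := fun n x =>
    Cadd (Csin_primitive (Csub (k n) w) x) (Csin_primitive (Cadd (k n) w) x)).
  assert (kpos : forall n, INR (2 * n + 1) <> 0) by (intros n; apply not_0_INR; lia).
  (* At [PI / 2] the factor [cos (k PI / 2)] vanishes and [sin (k PI / 2) = (-1)^n], so both
     numerators reduce to [(-1)^n cos (w PI / 2)]. *)
  assert (Aend : forall n, A n (PI / 2) = Cmul (Ccos (Cmul w (RtoC (PI / 2)))) (sec_term w n)).
  { intros n; destruct (odd_sub_neq_0 w n Hw) as [H1 H2].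
    unfold A, sec_term, Csin_primitive; fold (k n) in H1, H2 |- *.
    set (h := RtoC (PI / 2)) in *.
    replace (Cmul (Csub (k n) w) h) with (Cadd (Cmul (k n) h) (Copp (Cmul w h))) by ring.
    replace (Cmul (Cadd (k n) w) h) with (Cadd (Cmul (k n) h) (Cmul w h)) by ring.
    rewrite !Csin_plus, Ccos_opp, Csin_opp.
    replace (Cmul (k n) h) with (RtoC (INR (2 * n + 1) * (PI / 2))) by apply RtoC_mult.
    rewrite RtoC_Ccos, RtoC_Csin, sin_odd_mul_PI2, cos_odd_mul_PI2.
    field; auto. }
  assert (Asum : forall n x, Cadd (Ccos (Cmul (Csub (k n) w) (RtoC x)))
      (Ccos (Cmul (Cadd (k n) w) (RtoC x)))
    = Cmul (RtoC (2 * cos (INR (2 * n + 1) * x))) (Ccos (Cmul w (RtoC x)))).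
  { intros n x; rewrite RtoC_mult, <- RtoC_Ccos.
    replace (Cmul (Cmul (RtoC 2) (Ccos (RtoC (INR (2 * n + 1) * x)))) (Ccos (Cmul w (RtoC x))))
      with (Cmul (RtoC 2) (Cmul (Ccos (RtoC (INR (2 * n + 1) * x))) (Ccos (Cmul w (RtoC x)))))
      by ring.
    rewrite Ccos_mul_Ccos, RtoC_mult; fold (k n).
    replace (Cmul (Csub (k n) w) (RtoC x)) with (Csub (Cmul (k n) (RtoC x)) (Cmul w (RtoC x)))
      by ring.
    replace (Cmul (Cadd (k n) w) (RtoC x)) with (Cadd (Cmul (k n) (RtoC x)) (Cmul w (RtoC x)))
      by ring.
    ring. }
  assert (A0 : forall n, A n 0 = RtoC 0).
  { intros n; unfold A, Csin_primitive.
    replace (Cmul (Csub (k n) w) (RtoC 0)) with (RtoC 0) by ring.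
    replace (Cmul (Cadd (k n) w) (RtoC 0)) with (RtoC 0) by ring.
    rewrite RtoC_Csin, sin_0; field.
    destruct (odd_sub_neq_0 w n Hw); auto. }
  assert (AD : forall n x,
    is_derive (fun y => Re (A n y)) x
      (2 * cos (INR (2 * n + 1) * x) * Re (Ccos (Cmul w (RtoC x)))) /\
    is_derive (fun y => Im (A n y)) x
      (2 * cos (INR (2 * n + 1) * x) * Im (Ccos (Cmul w (RtoC x))))).
  { intros n x; destruct (odd_sub_neq_0 w n Hw) as [H1 H2].
    destruct (is_derive_Csin_primitive _ x H1) as [D1 D2].
    destruct (is_derive_Csin_primitive _ x H2) as [D3 D4].
    pose proof (Asum n x) as S; fold (k n) in D1, D2, D3, D4.
    split.
    - apply (f_equal Re) in S; evar_last; [apply @is_derive_plus; [exact D1 | exact D3]|].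
      etransitivity; [exact S | unfold Re, Cmul, RtoC; simpl; ring].
    - apply (f_equal Im) in S; evar_last; [apply @is_derive_plus; [exact D2 | exact D4]|].
      etransitivity; [exact S | unfold Im, Cmul, RtoC; simpl; ring]. }
  (* The real part of [cos (w x)] is 1 at 0, so [2 sin (k x) / k], the primitive of [2 cos (k x)],
     is subtracted termwise before localizing. The imaginary part already vanishes at 0. *)
  assert (Aend_cv : Ccv (Csum (fun n => A n (PI / 2))) (RtoC (PI / 2))).
  { destruct (Ccos_line_derive w) as [f [g [B [Df [Dg Hb]]]]].
    assert (Hre : Un_cv (fun N => sum_f_R0 (fun n => Re (A n (PI / 2))
        - 2 * (sin (INR (2 * n + 1) * (PI / 2)) / INR (2 * n + 1))) N) 0).
    { apply (dirichlet_kernel_localization (fun x => Re (Ccos (Cmul w (RtoC x))) - 1) f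
        (fun N x => sum_f_R0 (fun n => Re (A n x)
          - 2 * (sin (INR (2 * n + 1) * x) / INR (2 * n + 1))) N) B).
      - replace (Cmul w (RtoC 0)) with (RtoC 0) by ring.
        rewrite RtoC_Ccos, cos_0; unfold Re, RtoC; simpl; ring.
      - intros x; evar_last.
        + apply @is_derive_minus; [apply Df | apply @is_derive_const].
        + unfold minus, plus, opp, zero; simpl; ring.
      - intros x Hx; apply Hb, Hx.
      - intros N x; evar_last.
        + apply (is_derive_sum_f_R0 (fun n x => Re (A n x)
            - 2 * (sin (INR (2 * n + 1) * x) / INR (2 * n + 1)))
            (fun n x => 2 * cos (INR (2 * n + 1) * x) * Re (Ccos (Cmul w (RtoC x)))
               - 2 * cos (INR (2 * n + 1) * x))).
          intros n; apply @is_derive_minus; [apply AD|].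
          specialize (kpos n); generalize dependent (INR (2 * n + 1)); intros r Hr.
          auto_derive; [trivial | field; exact Hr].
        + unfold odd_cos_sum; rewrite scal_sum.
          apply sum_eq; intros n _; ring.
      - intros N; apply sum_eq_R0; intros n _.
        rewrite A0, Rmult_0_r, sin_0; unfold Re, RtoC; simpl fst; field; apply kpos. }
    assert (Him : Un_cv (fun N => sum_f_R0 (fun n => Im (A n (PI / 2))) N) 0).
    { apply (dirichlet_kernel_localization (fun x => Im (Ccos (Cmul w (RtoC x)))) g
        (fun N x => sum_f_R0 (fun n => Im (A n x)) N) B).
      - replace (Cmul w (RtoC 0)) with (RtoC 0) by ring.
        rewrite RtoC_Ccos; reflexivity.
      - apply Dg.
      - intros x Hx; apply Hb, Hx.
      - intros N x; evar_last.
        + apply (is_derive_sum_f_R0 (fun n x => Im (A n x))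
            (fun n x => 2 * cos (INR (2 * n + 1) * x) * Im (Ccos (Cmul w (RtoC x))))).
          intros n; apply AD.
        + unfold odd_cos_sum; rewrite scal_sum.
          apply sum_eq; intros n _; ring.
      - intros N; apply sum_eq_R0; intros n _; rewrite A0; reflexivity. }
    split.
    - pose proof (CV_plus _ _ _ _ Hre
        (CV_mult _ _ _ _ (Un_cv_const 2) leibniz_series)) as H.
      (* At [PI / 2] the subtracted terms are twice those of the Leibniz series, whose sum is added
         back. *)
      replace (Re (RtoC (PI / 2))) with (0 + 2 * (PI / 4)) by (unfold Re, RtoC; simpl; field).
      eapply Un_cv_ext; [|exact H]; intros N; cbv beta.
      rewrite Re_Csum, scal_sum, <- sum_plus.
      apply sum_eq; intros n _; rewrite sin_odd_mul_PI2; unfold Rdiv; ring.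
    - eapply Un_cv_ext; [|exact Him]; intros N; simpl; now rewrite Im_Csum. }
  replace (Cdiv (RtoC (PI / 2)) (Ccos (Cmul w (RtoC (PI / 2)))))
    with (Cmul (Cinv (Ccos (Cmul w (RtoC (PI / 2))))) (RtoC (PI / 2))) by (field; exact Hcos).
  eapply Ccv_ext; [|apply Ccv_mult_const, Aend_cv].
  intros N; simpl; rewrite (Csum_ext _ _ N Aend), Csum_mult_const; field; exact Hcos.
Qed.

(** * Quotients of Pochhammer symbols *)

Lemma Cadd_neq_0_of_not_Z0minus (t : Cplx) (n : nat) :
  ~ in_Z0minus t -> Cadd t (RtoC (INR n)) <> RtoC 0.
Proof.
  intros H E; apply H; exists n; rewrite RtoC_opp.
  replace t with (Csub (Cadd t (RtoC (INR n))) (RtoC (INR n))) by ring.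
  rewrite E; ring.
Qed.

Lemma poch_neq_0 (t : Cplx) (n : nat) : ~ in_Z0minus t -> poch t n <> RtoC 0.
Proof.
  intros H; induction n as [|n IH]; simpl.
  - intros E; apply RtoC_inj in E; lra.
  - apply Cmul_neq_0; [exact IH | now apply Cadd_neq_0_of_not_Z0minus].
Qed.

(** Both sides are the product [t (t+1) ... (t+n)]. *)
Lemma poch_shift (t : Cplx) (n : nat) :
  Cmul t (poch (Cadd (RtoC 1) t) n) = Cmul (poch t n) (Cadd t (RtoC (INR n))).
Proof.
  induction n as [|n IH]; [simpl; ring|].
  cbn [poch]; rewrite S_INR, RtoC_plus.
  transitivity (Cmul (Cmul t (poch (Cadd (RtoC 1) t) n))
    (Cadd (Cadd (RtoC 1) t) (RtoC (INR n)))); [ring|].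
  rewrite IH; ring.
Qed.

Lemma poch_1 (n : nat) : poch (RtoC 1) n = RtoC (INR (Factorial.fact n)).
Proof.
  induction n as [|n IH]; [reflexivity|].
  cbn [poch]; rewrite IH, <- RtoC_plus, <- RtoC_mult, fact_simpl, mult_INR, S_INR.
  f_equal; ring.
Qed.

(** [poch_shift] solved for either symbol: this form serves the numerator parameters [t1], ...,
    [t4], while [poch_mul] serves 3/2 and [3/2 - nu], [3/2 + nu]. *)
Lemma poch_div (t : Cplx) (n : nat) :
  Cadd t (RtoC (INR n)) <> RtoC 0 ->
  poch t n = Cdiv (Cmul t (poch (Cadd (RtoC 1) t) n)) (Cadd t (RtoC (INR n))).
Proof. intros H; rewrite poch_shift; field; exact H. Qed.

Lemma poch_mul (t : Cplx) (n : nat) :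
  t <> RtoC 0 ->
  poch (Cadd (RtoC 1) t) n = Cdiv (Cmul (poch t n) (Cadd t (RtoC (INR n)))) t.
Proof. intros H; rewrite <- poch_shift; field; exact H. Qed.

Lemma Cpow_RtoC (x : R) (n : nat) : Cpow (RtoC x) n = RtoC (x ^ n).
Proof. induction n as [|n IH]; simpl; [reflexivity | now rewrite IH, RtoC_mult]. Qed.

Lemma hyp_partial_Csum (alphas betas : list Cplx) (z : Cplx) (N : nat) :
  hyp_partial alphas betas z N = Csum (hyp_term alphas betas z) N.
Proof. induction N as [|N IH]; simpl; rewrite ?IH; reflexivity. Qed.

Lemma RtoC_neq (x y : R) : x <> y -> RtoC x <> RtoC y.
Proof. intros H E; apply H, RtoC_inj, E. Qed.

(** Two is spelled as a sum of ones because [field] treats [RtoC 2] as an indeterminate. *)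
Lemma two_neq_0 : Cadd (RtoC 1) (RtoC 1) <> RtoC 0.
Proof. rewrite <- RtoC_plus; apply RtoC_neq; lra. Qed.

Lemma RtoC_2 : RtoC 2 = Cadd (RtoC 1) (RtoC 1).
Proof. rewrite <- RtoC_plus; f_equal; lra. Qed.

Lemma RtoC_half : RtoC (1 / 2) = Cinv (Cadd (RtoC 1) (RtoC 1)).
Proof. rewrite <- RtoC_2, <- RtoC_inv by lra; f_equal; lra. Qed.

Lemma half_not_Z0minus : ~ in_Z0minus (RtoC (1 / 2)).
Proof.
  intros [k E]; apply RtoC_inj in E; pose proof (pos_INR k); lra.
Qed.

Lemma not_Z0minus_neq_0 (t : Cplx) : ~ in_Z0minus t -> t <> RtoC 0.
Proof.
  intros H E; apply H; exists O; rewrite E; f_equal; simpl; ring.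
Qed.

(** * The terms of the series as rational functions of the index *)

(** [(1)_n] cancels [n!], and every other upper parameter differs by 1 from a lower one, so each
    such pair leaves a single factor of the form [(u + n) / u] or [t / (t + n)]. *)
Lemma hyp_term_rational (nu t1 t2 t3 t4 : Cplx) (n : nat) :
  let half := RtoC (1 / 2) in
  let x := RtoC (INR n) in
  ~ in_Z0minus (Csub half nu) -> ~ in_Z0minus (Cadd half nu) ->
  ~ in_Z0minus (Cadd (RtoC 1) t1) -> ~ in_Z0minus (Cadd (RtoC 1) t2) ->
  ~ in_Z0minus (Cadd (RtoC 1) t3) -> ~ in_Z0minus (Cadd (RtoC 1) t4) ->
  Cadd t1 x <> RtoC 0 -> Cadd t2 x <> RtoC 0 ->
  Cadd t3 x <> RtoC 0 -> Cadd t4 x <> RtoC 0 ->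
  hyp_term
    [RtoC 1; RtoC (3/2); Csub (RtoC (3/2)) nu; Cadd (RtoC (3/2)) nu; t1; t2; t3; t4]
    [half; Csub half nu; Cadd half nu;
     Cadd (RtoC 1) t1; Cadd (RtoC 1) t2; Cadd (RtoC 1) t3; Cadd (RtoC 1) t4]
    (RtoC (-1)) n =
  Cmul (RtoC ((-1) ^ n))
    (Cmul (Cdiv (Cadd half x) half)
      (Cmul (Cdiv (Cmul (Cadd (Csub half nu) x) (Cadd (Cadd half nu) x))
                  (Cmul (Csub half nu) (Cadd half nu)))
        (Cdiv (Cmul (Cmul t1 t2) (Cmul t3 t4))
           (Cmul (Cmul (Cadd t1 x) (Cadd t2 x)) (Cmul (Cadd t3 x) (Cadd t4 x)))))).
Proof.
  intros half x Hm Hp H1 H2 H3 H4 E1 E2 E3 E4.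
  assert (E32 : RtoC (3 / 2) = Cadd (RtoC 1) half)
    by (unfold half; rewrite <- RtoC_plus; f_equal; lra).
  unfold hyp_term, Cprod; cbn [map fold_right].
  replace (Csub (RtoC (3 / 2)) nu) with (Cadd (RtoC 1) (Csub half nu)) by (rewrite E32; ring).
  replace (Cadd (RtoC (3 / 2)) nu) with (Cadd (RtoC 1) (Cadd half nu)) by (rewrite E32; ring).
  rewrite E32, Cpow_RtoC, poch_1.
  rewrite (poch_mul half), (poch_mul (Csub half nu)), (poch_mul (Cadd half nu))
    by (apply not_Z0minus_neq_0; assumption || apply half_not_Z0minus).
  rewrite (poch_div t1), (poch_div t2), (poch_div t3), (poch_div t4) by assumption.
  pose proof (poch_neq_0 half n half_not_Z0minus) as N0.
  pose proof (poch_neq_0 _ n Hm) as Nm; pose proof (poch_neq_0 _ n Hp) as Np.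
  pose proof (poch_neq_0 _ n H1) as N1; pose proof (poch_neq_0 _ n H2) as N2.
  pose proof (poch_neq_0 _ n H3) as N3; pose proof (poch_neq_0 _ n H4) as N4.
  apply not_Z0minus_neq_0 in Hm, Hp.
  pose proof (not_Z0minus_neq_0 _ half_not_Z0minus) as Hh; fold half in Hh.
  assert (Nf : RtoC (INR (Factorial.fact n)) <> RtoC 0) by (apply RtoC_neq, INR_fact_neq_0).
  fold x; field; repeat split; assumption.
Qed.

(* The condition on [nu] makes [k^2/4 - nu^2] the mean of [(k^2 - w1^2)/4] and
   [(k^2 - w2^2)/4], which splits the term into two secant terms. *)
Lemma hyp_term_sec_terms (nu w1 w2 : Cplx) (n : nat) :
  let half := RtoC (1 / 2) in
  let t1 := Cmul half (Csub (RtoC 1) w1) in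
  let t2 := Cmul half (Csub (RtoC 1) w2) in
  let t3 := Cmul half (Cadd (RtoC 1) w1) in
  let t4 := Cmul half (Cadd (RtoC 1) w2) in
  ~ is_odd_int w1 -> ~ is_odd_int w2 ->
  Cmul (RtoC 2) (Cmul (Cmul (RtoC 2) nu) (Cmul (RtoC 2) nu))
    = Cadd (Cmul w1 w1) (Cmul w2 w2) ->
  ~ in_Z0minus (Csub half nu) -> ~ in_Z0minus (Cadd half nu) ->
  ~ in_Z0minus (Cadd (RtoC 1) t1) -> ~ in_Z0minus (Cadd (RtoC 1) t2) ->
  ~ in_Z0minus (Cadd (RtoC 1) t3) -> ~ in_Z0minus (Cadd (RtoC 1) t4) ->
  hyp_term
    [RtoC 1; RtoC (3/2); Csub (RtoC (3/2)) nu; Cadd (RtoC (3/2)) nu; t1; t2; t3; t4]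
    [half; Csub half nu; Cadd half nu;
     Cadd (RtoC 1) t1; Cadd (RtoC 1) t2; Cadd (RtoC 1) t3; Cadd (RtoC 1) t4]
    (RtoC (-1)) n =
  Cmul (Cdiv (Cmul (Cmul t1 t2) (Cmul t3 t4)) (Cmul (Csub half nu) (Cadd half nu)))
    (Cadd (sec_term w1 n) (sec_term w2 n)).
Proof.
  intros half t1 t2 t3 t4 O1 O2 Hnu Hm Hp H1 H2 H3 H4.
  destruct (odd_sub_neq_0 w1 n O1) as [K1 K3]; destruct (odd_sub_neq_0 w2 n O2) as [K2 K4].
  unfold sec_term.
  set (x := RtoC (INR n)) in *; set (k := RtoC (INR (2 * n + 1))) in *.
  assert (Hk : k = Cadd (Cmul (RtoC 2) x) (RtoC 1)).
  { unfold k, x; rewrite plus_INR, mult_INR, RtoC_plus, RtoC_mult; reflexivity. }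
  pose proof two_neq_0 as T.
  pose proof (not_Z0minus_neq_0 _ half_not_Z0minus) as Hh; fold half in Hh.
  assert (Ehalf : half = Cinv (Cadd (RtoC 1) (RtoC 1))) by apply RtoC_half.
  rewrite RtoC_2 in Hk, Hnu.
  assert (X1 : Cadd t1 x = Cmul half (Csub k w1)) by (unfold t1; rewrite Ehalf, Hk; field; exact T).
  assert (X2 : Cadd t2 x = Cmul half (Csub k w2)) by (unfold t2; rewrite Ehalf, Hk; field; exact T).
  assert (X3 : Cadd t3 x = Cmul half (Cadd k w1)) by (unfold t3; rewrite Ehalf, Hk; field; exact T).
  assert (X4 : Cadd t4 x = Cmul half (Cadd k w2)) by (unfold t4; rewrite Ehalf, Hk; field; exact T).
  unfold half; rewrite hyp_term_rational; fold half x; try assumption;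
    [| rewrite X1 | rewrite X2 | rewrite X3 | rewrite X4];
    [| apply Cmul_neq_0; assumption ..].
  rewrite X1, X2, X3, X4.
  (* The pair 3/2 over 1/2 provides the factor [k] needed in [2 k / (k^2 - w^2) = 1 / (k - w) + 1 /
     (k + w)]. *)
  replace (Cadd half x) with (Cmul half k) by (rewrite Ehalf, Hk; field; exact T).
  assert (Hn : Cmul (Cadd (Csub half nu) x) (Cadd (Cadd half nu) x)
    = Cmul (Cmul half (Cmul half half))
       (Cadd (Cmul (Csub k w1) (Cadd k w1)) (Cmul (Csub k w2) (Cadd k w2)))).
  { transitivity (Csub (Cmul (Cmul half half) (Cmul k k)) (Cmul nu nu)).
    - rewrite Ehalf, Hk; field; exact T.
    - assert (Hw : Cmul w1 w1 = Csub (Cmul (Cadd (RtoC 1) (RtoC 1)) (Cmul (Cmul (Cadd (RtoC 1) (RtoC 1)) nu) (Cmul (Cadd (RtoC 1) (RtoC 1)) nu))) (Cmul w2 w2))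
        by (rewrite Hnu; ring).
      transitivity (Cmul (Cmul half (Cmul half half))
        (Csub (Cmul (Cadd (RtoC 1) (RtoC 1)) (Cmul k k)) (Cadd (Cmul w1 w1) (Cmul w2 w2)))).
      + rewrite Hw, Ehalf; field; exact T.
      + ring. }
  rewrite Hn.
  apply not_Z0minus_neq_0 in Hm, Hp.
  (* From here on [nu] enters only through the constant denominators, which may be arbitrary nonzero
     elements. *)
  revert Hm Hp; generalize (Csub half nu), (Cadd half nu); intros dm dp Hm Hp.
  rewrite Ehalf.
  field; repeat split; auto; apply RtoC_neq; lra.
Qed.

(** * Summation of the series and comparison with the closed form *)

Theorem mainTheorem9 (a b c s : Cplx)
  (hb : 0 < Re b)
  (h1 : 0 < Re (Cadd b (Cadd a c)))
  (h2 : 0 < Re (Csub (Cadd b a) c))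
  (h3 : 0 < Re (Cadd (Csub b a) c))
  (h4 : 0 < Re (Csub (Csub b a) c))
  (hodd1 : ~ is_odd_int (Cdiv (Cadd a c) b))
  (hodd2 : ~ is_odd_int (Cdiv (Csub a c) b))
  (hs : Cmul s s = Cadd (Cmul a a) (Cmul c c)) :
  let nu := Cdiv s (Cmul (RtoC 2) b) in
  let half := RtoC (1/2) in
  let t1 := Csub half (Cdiv (Cadd a c) (Cmul (RtoC 2) b)) in
  let t2 := Csub half (Cdiv (Csub a c) (Cmul (RtoC 2) b)) in
  let t3 := Cadd half (Cdiv (Cadd a c) (Cmul (RtoC 2) b)) in
  let t4 := Cadd half (Cdiv (Csub a c) (Cmul (RtoC 2) b)) in
  let Q := Cmul (Cmul (Csub (Csub b a) c) (Cadd b (Cadd a c)))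
                (Cmul (Cadd (Csub b a) c) (Csub (Cadd b a) c)) in
  ~ in_Z0minus (Csub half nu) ->
  ~ in_Z0minus (Cadd half nu) ->
  ~ in_Z0minus (Cadd (RtoC 1) t1) ->
  ~ in_Z0minus (Cadd (RtoC 1) t2) ->
  ~ in_Z0minus (Cadd (RtoC 1) t3) ->
  ~ in_Z0minus (Cadd (RtoC 1) t4) ->
  hyp_sum
    [RtoC 1; RtoC (3/2); Csub (RtoC (3/2)) nu; Cadd (RtoC (3/2)) nu; t1; t2; t3; t4]
    [half; Csub half nu; Cadd half nu;
     Cadd (RtoC 1) t1; Cadd (RtoC 1) t2; Cadd (RtoC 1) t3; Cadd (RtoC 1) t4]
    (RtoC (-1))
    (Cmul
      (Cdiv (Cmul (RtoC PI) Q)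
            (Cmul (RtoC 2)
               (Csub (Csub (Cpow b 4) (Cmul (Cmul a a) (Cmul b b)))
                     (Cmul (Cmul c c) (Cmul b b)))))
      (Cdiv (Cmul (Ccos (Cdiv (Cmul a (RtoC PI)) (Cmul (RtoC 2) b)))
                  (Ccos (Cdiv (Cmul c (RtoC PI)) (Cmul (RtoC 2) b))))
            (Cadd (Ccos (Cdiv (Cmul c (RtoC PI)) b))
                  (Ccos (Cdiv (Cmul a (RtoC PI)) b))))).
Proof.
  intros nu half t1 t2 t3 t4 Q Hm Hp H1 H2 H3 H4.
  set (w1 := Cdiv (Cadd a c) b) in *; set (w2 := Cdiv (Csub a c) b) in *.
  pose proof two_neq_0 as T.
  assert (Hb : b <> RtoC 0) by (intros E; rewrite E in hb; unfold Re in hb; simpl in hb; lra).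
  assert (E1 : t1 = Cmul half (Csub (RtoC 1) w1))
    by (unfold t1, half, w1; rewrite RtoC_half, RtoC_2; field; auto).
  assert (E2 : t2 = Cmul half (Csub (RtoC 1) w2))
    by (unfold t2, half, w2; rewrite RtoC_half, RtoC_2; field; auto).
  assert (E3 : t3 = Cmul half (Cadd (RtoC 1) w1))
    by (unfold t3, half, w1; rewrite RtoC_half, RtoC_2; field; auto).
  assert (E4 : t4 = Cmul half (Cadd (RtoC 1) w2))
    by (unfold t4, half, w2; rewrite RtoC_half, RtoC_2; field; auto).
  (* Parallelogram identity: [(a+c)^2 + (a-c)^2 = 2 (a^2 + c^2)], divided by [b^2]. *)
  assert (Hnu : Cmul (RtoC 2) (Cmul (Cmul (RtoC 2) nu) (Cmul (RtoC 2) nu))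
                = Cadd (Cmul w1 w1) (Cmul w2 w2)).
  { transitivity (Cdiv (Cmul (RtoC 2) (Cmul s s)) (Cmul b b)).
    - unfold nu; rewrite RtoC_2; field; auto.
    - rewrite hs; unfold w1, w2; rewrite RtoC_2; field; auto. }
  pose proof (Ccos_neq_0 w1 hodd1) as C1; pose proof (Ccos_neq_0 w2 hodd2) as C2.
  set (K := Cdiv (Cmul (Cmul t1 t2) (Cmul t3 t4)) (Cmul (Csub half nu) (Cadd half nu))).
  assert (Hterm : forall n, hyp_term
    [RtoC 1; RtoC (3/2); Csub (RtoC (3/2)) nu; Cadd (RtoC (3/2)) nu; t1; t2; t3; t4]
    [half; Csub half nu; Cadd half nu;
     Cadd (RtoC 1) t1; Cadd (RtoC 1) t2; Cadd (RtoC 1) t3; Cadd (RtoC 1) t4]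
    (RtoC (-1)) n = Cmul K (Cadd (sec_term w1 n) (sec_term w2 n))).
  { intros n; unfold K; rewrite E1, E2, E3, E4 in *; now apply hyp_term_sec_terms. }
  change (Ccv (hyp_partial
    [RtoC 1; RtoC (3/2); Csub (RtoC (3/2)) nu; Cadd (RtoC (3/2)) nu; t1; t2; t3; t4]
    [half; Csub half nu; Cadd half nu;
     Cadd (RtoC 1) t1; Cadd (RtoC 1) t2; Cadd (RtoC 1) t3; Cadd (RtoC 1) t4]
    (RtoC (-1)))
    (Cmul
      (Cdiv (Cmul (RtoC PI) Q)
            (Cmul (RtoC 2)
               (Csub (Csub (Cpow b 4) (Cmul (Cmul a a) (Cmul b b)))
                     (Cmul (Cmul c c) (Cmul b b)))))
      (Cdiv (Cmul (Ccos (Cdiv (Cmul a (RtoC PI)) (Cmul (RtoC 2) b)))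
                  (Ccos (Cdiv (Cmul c (RtoC PI)) (Cmul (RtoC 2) b))))
            (Cadd (Ccos (Cdiv (Cmul c (RtoC PI)) b))
                  (Ccos (Cdiv (Cmul a (RtoC PI)) b)))))).
  set (c1 := Ccos (Cmul w1 (RtoC (PI / 2)))) in *.
  set (c2 := Ccos (Cmul w2 (RtoC (PI / 2)))) in *.
  assert (EPI : RtoC (PI / 2) = Cmul half (RtoC PI))
    by (unfold half; rewrite <- RtoC_mult; f_equal; field).
  (* The angles [a PI / (2b)] and [c PI / (2b)] have sum [w1 PI / 2] and difference [w2 PI / 2]. *)
  assert (Hnum : Cmul (RtoC 2) (Cmul (Ccos (Cdiv (Cmul a (RtoC PI)) (Cmul (RtoC 2) b)))
                      (Ccos (Cdiv (Cmul c (RtoC PI)) (Cmul (RtoC 2) b)))) = Cadd c1 c2).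
  { rewrite Ccos_mul_Ccos; unfold c1, c2; rewrite EPI; unfold half, w1, w2.
    rewrite RtoC_half, RtoC_2; f_equal; f_equal; field; auto. }
  (* Conversely [w1 PI / 2] and [w2 PI / 2] have sum [a PI / b] and difference [c PI / b]. The
     quotient of cosines thus becomes [(c1 + c2) / (4 c1 c2)], a multiple of [1 / c1 + 1 / c2]. *)
  assert (Hden : Cadd (Ccos (Cdiv (Cmul c (RtoC PI)) b)) (Ccos (Cdiv (Cmul a (RtoC PI)) b))
                 = Cmul (RtoC 2) (Cmul c1 c2)).
  { unfold c1, c2; rewrite Ccos_mul_Ccos, EPI; unfold half, w1, w2.
    rewrite RtoC_half.
    transitivity (Cadd (Ccos (Cdiv (Cmul a (RtoC PI)) b)) (Ccos (Cdiv (Cmul c (RtoC PI)) b)));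
      [ring|].
    f_equal; f_equal; field; auto. }
  rewrite Hden.
  set (cc := Cmul (Ccos (Cdiv (Cmul a (RtoC PI)) (Cmul (RtoC 2) b)))
                  (Ccos (Cdiv (Cmul c (RtoC PI)) (Cmul (RtoC 2) b)))) in *.
  apply not_Z0minus_neq_0 in Hm, Hp.
  (* [b^2 (b^2 - s^2) = 4 b^4 (1/4 - nu^2)], so the assumptions on [nu] keep this denominator from
     vanishing. *)
  assert (Hpoly : Csub (Csub (Cpow b 4) (Cmul (Cmul a a) (Cmul b b)))
                       (Cmul (Cmul c c) (Cmul b b))
    = Cmul (Cmul (Cmul (RtoC 2) (RtoC 2)) (Cmul (Cmul b b) (Cmul b b)))
        (Cmul (Csub half nu) (Cadd half nu))).
  { transitivity (Cmul (Cmul b b) (Csub (Cmul b b) (Cadd (Cmul a a) (Cmul c c))));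
      [simpl; ring|].
    rewrite <- hs; unfold half, nu; rewrite RtoC_half, RtoC_2; field; auto. }
  (* Each linear factor of [Q] is [2 b] times one of [t1], ..., [t4]. *)
  assert (HQ : Q = Cmul (Cmul (Cmul (Cmul (RtoC 2) (RtoC 2)) (Cmul (RtoC 2) (RtoC 2)))
                   (Cmul (Cmul b b) (Cmul b b))) (Cmul (Cmul t1 t2) (Cmul t3 t4))).
  { unfold Q; rewrite E1, E2, E3, E4; unfold half, w1, w2; rewrite RtoC_half, RtoC_2.
    field; auto. }
  rewrite Hpoly, HQ.
  replace cc with (Cmul half (Cadd c1 c2))
    by (rewrite <- Hnum; unfold half; rewrite RtoC_half, RtoC_2; field; exact T).
  match goal with |- Ccv _ ?L => replace L with
    (Cmul K (Cadd (Cdiv (RtoC (PI / 2)) c1) (Cdiv (RtoC (PI / 2)) c2))) end.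
  - eapply Ccv_ext; [|apply Ccv_mult_const, Ccv_plus; apply secant_series; assumption].
    intros N; cbv beta; rewrite hyp_partial_Csum, (Csum_ext _ _ N Hterm).
    rewrite Csum_mult_const, Csum_plus; reflexivity.
  - unfold K; rewrite EPI.
    revert Hm Hp; generalize (Csub half nu), (Cadd half nu); intros dm dp Hm Hp.
    clearbody t1 t2 t3 t4 c1 c2.
    unfold half; rewrite RtoC_half; rewrite <- RtoC_2 in *.
    (* Both sides carry the same power of 2, so the identity holds with any nonzero element in its
       place. *)
    generalize dependent (RtoC 2); intros two T; intros.
    field; repeat split; auto.
Qed.
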